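(* Let $R=\langle W,I,G,O,M\rangle$ be an online goal recognition problem in continuous spaces and let $\textit{planner}$ be a planner. If the heuristic $\mathrm{RECOMPUTE}$ is the constant function $\bot$ (always false), then the algorithm Online Goal Recognition, run on $(R,\textit{planner})$, makes exactly $|G|$ calls to the planner.
   Context: **Problem.** An online goal recognition problem in continuous spaces is a quintuple $R=\langle W,I,G,O,M\rangle$, where: $W\subseteq\mathbb{R}^n$ is the world; $I\in W$ is the initial pose of the observed agent; $G$ is a finite set of goals, each $g\in G$ being a point of $W$; $O$ is a finite set of observations, revealed one at a time in sequence, each $o\in O$ being a subset of $W$ (a point or a trajectory); $M$ is a (potentially infinite) set of plan trajectories, each beginning in $I$ and ending at some goal $g\in G$, such that for each $g\in G$ there is at least one plan in $M$ ending at $g$. In the claim, $|G|$ refers to the set $G$ given in the input $R$. **Planner.** A planner is a black-box procedure: $\textit{planner}(x,g)$ returns a trajectory from $x$ to $g$ (when $x$ is an observation, the trajectory starts at the last point of $x$). Each invocation of $\textit{planner}$ counts as one planner call. No other operation below calls the planner. **Notation.** $\oplus$ denotes concatenation of trajectories. For a trajectory $m_g^+$ and an observation $o$, $\textit{prefix}(o,m_g^+)$ is the part of $m_g^+$ from its beginning to the point of $m_g^+$ geometrically closest to $o$, and $\ominus$ denotes removing that initial part. For each goal, $\textit{score}(g)=\mathrm{cost}(i_g)/\mathrm{cost}(m_g)$ and $\eta=1/\sum_{g\in G}\textit{score}(g)$. **Algorithm Online Goal Recognition $(R,\textit{planner})$**, parametrized by two Boolean-valued heuristic functions $\mathrm{RECOMPUTE}(m_\upsilon,o)$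 and $\mathrm{PRUNE}(m_g^+,o,g)$ (neither of which calls the planner): 1. For all $g\in G$: set $m_g,m_g^-\leftarrow\emptyset$. Set $\upsilon\leftarrow\emptyset$ (the top-ranked goal). 2. For all $g\in G$: $i_g\leftarrow\textit{planner}(I,g)$; $m_g^+\leftarrow i_g$. 3. While a new observation $o\in O$ is available: (a) If $\mathrm{RECOMPUTE}(m_\upsilon,o)$ is true: for all $g\in G$, if $\mathrm{PRUNE}(m_g^+,o,g)$ is true then $G\leftarrow G\setminus\{g\}$, else $m_g^+\leftarrow\textit{planner}(o,g)$. (b) Otherwise: for all $g\in G$, $m_g^+\leftarrow m_g^+\ominus\textit{prefix}(o,m_g^+)$. (c) For all $g\in G$: $m_g^-\leftarrow m_g^-\oplus o$ and $m_g\leftarrow m_g^-\oplus m_g^+$. (d) For all $g\in G$: $Pr(g\mid O)\leftarrow\eta\cdot\textit{score}(g)$. (e) $\upsilon\leftarrow\arg\max_{g\in G}Pr(g\mid O)$. *)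

(* Defs.v *)
From HB Require Import structures.
From mathcomp Require Import all_boot all_order all_algebra finmap.
From mathcomp Require Import all_classical all_reals all_analysis.

Set Implicit Arguments.
Unset Strict Implicit.
Unset Printing Implicit Defensive.

Import Order.TTheory GRing.Theory Num.Theory.
Import numFieldNormedType.Exports.

Local Open Scope classical_set_scope.
Local Open Scope ring_scope.

(* A continuous trajectory, parametrised by [0, 1]; the values of [curve_fun]
   outside [0, 1] are irrelevant. A single point is a constant curve. *)
Record curve (R : realType) (n : nat) := Curve {
  curve_fun :> R -> 'rV[R]_n ;
  curve_continuous : {within `[0, 1], continuous curve_fun} }.

HB.instance Definition _ (R : realType) (n : nat) := gen_eqMixin (curve R n).
HB.instance Definition _ (R : realType) (n : nat) := gen_choiceMixin (curve R n).

(* A concatenation of curves, whose consecutive end points need not agree (the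
   successive observations need not be adjacent): [::] is the empty trajectory
   and ++ is concatenation. *)
Definition trajectory (R : realType) (n : nat) := seq (curve R n).

Section Curves.
Variables (R : realType) (n : nat).
Implicit Types (x y : 'rV[R]_n) (m o : curve R n).

Definition source m : 'rV[R]_n := m 0.
Definition target m : 'rV[R]_n := m 1.
Definition trace m : set 'rV[R]_n := m @` `[0, 1].

Lemma cst_curve_continuous x :
  {within `[0, 1 : R], continuous (fun _ : R => x)}.
Proof. by apply: continuous_subspaceT => t; exact: cvg_cst. Qed.

Definition cst_curve x : curve R n := Curve (@cst_curve_continuous x).

(* The Euclidean distance: the library norm on 'rV[R]_n is the sup norm. *)
Definition edist x y : R := Num.sqrt (\sum_i (x 0 i - y 0 i) ^+ 2).

Definition edist_set x (A : set 'rV[R]_n) : R := inf [set edist x y | y in A].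

(* The times at which m passes through a point of m closest to o. *)
Definition closest_times o m : set R :=
  [set t | t \in `[0, 1] /\ forall s, s \in `[0, 1] ->
     edist_set (m t) (trace o) <= edist_set (m s) (trace o)].

(* The default value 1 is never used, see [closest_times_neq0]; ties between
   closest points are broken by an arbitrary fixed choice. *)
Definition closest_time o m : R := xget 1 (closest_times o m).

Lemma closest_time01 o m : closest_time o m \in `[0, 1].
Proof.
rewrite /closest_time; case: xgetP => [t _ [] //|_].
by rewrite in_itv /= ler01 lexx.
Qed.

Lemma edist_ge0 x y : 0 <= edist x y.
Proof. exact: sqrtr_ge0. Qed.

Lemma curve_cvg (T : Type) (F : set_system T) (FF : Filter F) (h : T -> R)
    m (t : R) :
  t \in `[0, 1] -> h @ F --> t -> (\forall w \near F, h w \in `[0, 1]) ->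
  (fun w => m (h w)) @ F --> m t.
Proof.
move=> t01 ht h01.
have /subspace_continuousP/(_ _ t01) := @curve_continuous _ _ m.
apply: cvg_comp => B; rewrite /= nbhs_simpl /within /= => nB.
have Fh := ht _ nB; rewrite nbhs_simpl /= in Fh.
by apply: filterS2 h01 Fh => w hw; exact.
Qed.

Lemma closest_times_neq0 o m : closest_times o m !=set0.
Proof.
pose A : set (R * R) := `[0, 1] `*` `[0, 1].
pose f (z : R * R) := edist (m z.1) (o z.2).
have A0 : A !=set0 by exists (0, 0); split; rewrite /= in_itv /= lexx ler01.
have cA : compact A by apply: compact_setX; exact: segment_compact.
have cf : {within A, continuous f}.
  apply/subspace_continuousP => -[t s] Ats; have [/= t01 s01] := Ats.
  have cm : (fun w : R * R => m w.1) @ within A (nbhs (t, s)) --> m t.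
    apply: (@curve_cvg _ _ _ fst) => //.
      by apply: cvg_within_filter; exact: cvg_fst.
    by apply: filterS (withinT _ _) => -[a b] [].
  have co : (fun w : R * R => o w.2) @ within A (nbhs (t, s)) --> o s.
    apply: (@curve_cvg _ _ _ snd) => //.
      by apply: cvg_within_filter; exact: cvg_snd.
    by apply: filterS (withinT _ _) => -[a b] [].
  rewrite /f /edist; apply: continuous_cvg; first exact: sqrt_continuous.
  apply: cvg_big => //; first exact: add_continuous.
  move=> i _.
  apply: (@continuous_cvg _ _ _ _ _ _ (fun u : R => u ^+ 2)).
    exact: exprn_continuous.
  by apply: cvgB;
    apply: (@continuous_cvg _ _ _ _ _ _ (fun u : 'rV[R]_n => u 0 i)) => //;
    exact: coord_continuous.
have [[t s]] := compact_EVT_min A0 cA cf.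
rewrite inE => -[/= t01 s01] fmin.
exists t; split=> // t' t'01.
apply: (@le_trans _ _ (f (t, s))).
  apply: ge_inf; last by exists (o s) => //; exists s.
  by exists 0 => _ [y _ <-]; exact: edist_ge0.
apply: lb_le_inf; first by exists (edist (m t') (o s)), (o s) => //; exists s.
by move=> _ [_ [s' s'01 <-] <-]; apply: (fmin (t', s')); rewrite inE.
Qed.

Lemma curve_after_continuous m (t : R) : t \in `[0, 1] ->
  {within `[0, 1], continuous (fun s => m (line_path t 1 s))}.
Proof.
move=> t01; apply/subspace_continuousP => s s01.
have ls r : r \in `[0, 1] -> line_path t 1 r \in `[0, 1].
  move: t01; rewrite !in_itv /= => /andP[t0 t1] /andP[r0 r1].
  apply/andP; split; first by rewrite addr_ge0 ?mulr_ge0 ?subr_ge0.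
  by rewrite /line_path mulr1 -lerBrDr -[leRHS]mulr1 ler_wpM2l ?subr_ge0.
apply: curve_cvg; first exact: ls.
  apply: cvg_within_filter; rewrite /line_path.
  by apply: cvgD; apply: cvgMr_tmp; [apply: cvgB; [exact: cvg_cst|]|].
by apply: filterS (withinT _ _) => r; exact: ls.
Qed.

(* What remains of m after its part on [0, t], reparametrised by [0, 1]. *)
Definition curve_after m (t : R) (t01 : t \in `[0, 1]) : curve R n :=
  Curve (@curve_after_continuous m t t01).

(* prefix(o, m) is the part of m on [0, closest_time o m]. *)
Definition remove_prefix o m : curve R n := @curve_after m _ (closest_time01 o m).

End Curves.

Record recognition_problem (R : realType) (n : nat) := RecognitionProblem {
  world : set 'rV[R]_n ;
  initial : 'rV[R]_n ;
  goals : {fset 'rV[R]_n} ;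
  observations : {fset curve R n} ;
  plans : set (curve R n) ;
  initial_world : world initial ;
  goals_world : forall g, g \in goals -> world g ;
  observations_world : forall o, o \in observations -> trace o `<=` world ;
  plans_source : forall m, plans m -> source m = initial ;
  plans_target : forall m, plans m -> target m \in goals ;
  plans_goals : forall g, g \in goals -> exists2 m, plans m & target m = g }.

(* planner x g goes from the last point of the observation x to g; a start at a
   pose p is a start at the constant curve at p. *)
Definition is_planner (R : realType) (n : nat) (pb : recognition_problem R n)
    (planner : curve R n -> 'rV[R]_n -> curve R n) : Prop :=
  forall x g, trace x `<=` world pb -> g \in goals pb ->
    source (planner x g) = target x /\ target (planner x g) = g.

(* Programs with an oracle: [Call x g k] asks for planner x g and continues
   with k applied to the answer. The planner cannot be accessed otherwise. *)
Inductive prog (R : realType) (n : nat) (A : Type) : Type :=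
| Ret of A
| Call of curve R n & 'rV[R]_n & (curve R n -> prog R n A).
Arguments Ret {R n A}.

Fixpoint bind (R : realType) (n : nat) (A B : Type) (p : prog R n A)
    (f : A -> prog R n B) : prog R n B :=
  match p with
  | Ret a => f a
  | Call x g k => Call x g (fun m => bind (k m) f)
  end.

Fixpoint foreach (R : realType) (n : nat) (A S : Type) (s : seq A)
    (body : A -> S -> prog R n S) (st : S) : prog R n S :=
  if s is a :: s' then bind (body a st) (foreach s' body) else Ret st.

(* The result of a program, with the number of calls made to the planner. *)
Fixpoint run (R : realType) (n : nat) (A : Type)
    (planner : curve R n -> 'rV[R]_n -> curve R n) (p : prog R n A) : A * nat :=
  match p with
  | Ret a => (a, 0%N)
  | Call x g k => let r := run planner (k (planner x g)) in (r.1, r.2.+1)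
  end.

Definition planner_calls (R : realType) (n : nat) (A : Type)
    (planner : curve R n -> 'rV[R]_n -> curve R n) (p : prog R n A) : nat :=
  (run planner p).2.

(* The variables updated by the main loop: the goals that have not been pruned,
   m_g^+, m_g^-, m_g, Pr(g | O) and the top-ranked goal. *)
Record state (R : realType) (n : nat) := State {
  live : {fset 'rV[R]_n} ;
  mplus : 'rV[R]_n -> curve R n ;
  mminus : 'rV[R]_n -> trajectory R n ;
  mfull : 'rV[R]_n -> trajectory R n ;
  posterior : 'rV[R]_n -> R ;
  top : option 'rV[R]_n }.

Section Algorithm.
Variables (R : realType) (n : nat).
Notation point := 'rV[R]_n.
Variables (pb : recognition_problem R n) (cost : trajectory R n -> R).
Variables (recompute : trajectory R n -> curve R n -> bool).
Variables (prune : curve R n -> curve R n -> point -> bool).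
Implicit Types (g : point) (o : curve R n) (st : state R n).

Definition upd (T : Type) (f : point -> T) g (v : T) : point -> T :=
  fun h => if h == g then v else f h.

(* The value outside the goals is a placeholder. *)
Definition initial_plans : prog R n (point -> curve R n) :=
  foreach (enum_fset (goals pb))
    (fun g i => Call (cst_curve (initial pb)) g (fun m => Ret (upd i g m)))
    (fun=> cst_curve (initial pb)).

Definition init_state (i : point -> curve R n) : state R n :=
  State (goals pb) i (fun=> [::]) (fun=> [::]) (fun=> 0) None.

(* m_upsilon; it is empty as long as there is no top-ranked goal. *)
Definition top_trajectory st : trajectory R n :=
  if top st is Some g then mfull st g else [::].

Definition remove_goal g st : state R n :=
  State (live st `\ g)%fset (mplus st) (mminus st) (mfull st) (posterior st)
    (top st).

Definition set_mplus (f : point -> curve R n) st : state R n :=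
  State (live st) f (mminus st) (mfull st) (posterior st) (top st).

Definition recompute_step o st : prog R n (state R n) :=
  foreach (enum_fset (live st))
    (fun g st => if prune (mplus st g) o g then Ret (remove_goal g st)
      else Call o g (fun m => Ret (set_mplus (upd (mplus st) g m) st)))
    st.

Definition shorten_step o st : state R n :=
  set_mplus (fun g => if g \in live st then remove_prefix o (mplus st g)
                      else mplus st g) st.

Definition concat_step o st : state R n :=
  let minus g := if g \in live st then mminus st g ++ [:: o]
                 else mminus st g in
  let full g := if g \in live st then minus g ++ [:: mplus st g]
                else mfull st g in
  State (live st) (mplus st) minus full (posterior st) (top st).

Definition score (i : point -> curve R n) st g : R :=
  cost [:: i g] / cost (mfull st g).

Definition rank_step (i : point -> curve R n) st : state R n :=
  let eta := 1 / \sum_(g <- enum_fset (live st)) score i st g in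
  let pr g := if g \in live st then eta * score i st g else posterior st g in
  State (live st) (mplus st) (mminus st) (mfull st) pr (top st).

(* An arbitrary maximiser, or None if there is no goal left. *)
Definition argmax_step st : state R n :=
  State (live st) (mplus st) (mminus st) (mfull st) (posterior st)
    (omap val [pick g : live st |
       [forall h : live st, posterior st (val h) <= posterior st (val g)]]).

Definition observe (i : point -> curve R n) o st : prog R n (state R n) :=
  bind (if recompute (top_trajectory st) o then recompute_step o st
        else Ret (shorten_step o st))
    (fun st' => Ret (argmax_step (rank_step i (concat_step o st')))).

(* [os] lists the observations in the order in which they are revealed. *)
Definition online_goal_recognition (os : seq (curve R n)) :
    prog R n (state R n) :=
  bind initial_plans (fun i => foreach os (observe i) (init_state i)).

End Algorithm.

(* Main.v *)
Require Import Defs.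
From mathcomp Require Import all_boot all_order all_algebra finmap.
From mathcomp Require Import all_classical all_reals all_analysis.

(** Calls add up along [bind] ([planner_calls_bind]), so a loop whose body costs the same [c] calls
    in every state costs [c] per entry of its list ([planner_calls_foreach]). Initialisation costs
    one call per goal. When [recompute] is always false, each observation takes the shortening
    branch, a pure computation, so the main loop costs nothing. *)

Lemma run_bind (R : realType) (n : nat) (A B : Type)
    (planner : curve R n -> 'rV[R]_n -> curve R n)
    (p : prog R n A) (f : A -> prog R n B) :
  run planner (bind p f) =
  ((run planner (f (run planner p).1)).1,
   (run planner p).2 + (run planner (f (run planner p).1)).2).
Proof.
elim: p => [a|x g k IHk] /=; first by rewrite add0n -surjective_pairing.
by rewrite IHk /= addSn.
Qed.

Lemma planner_calls_bind (R : realType) (n : nat) (A B : Type)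
    (planner : curve R n -> 'rV[R]_n -> curve R n)
    (p : prog R n A) (f : A -> prog R n B) :
  planner_calls planner (bind p f) =
  planner_calls planner p + planner_calls planner (f (run planner p).1).
Proof. by rewrite /planner_calls run_bind. Qed.

(** Requiring [c] to be uniform in the state removes any need for a loop invariant: the states
    produced along the way, which depend on the planner's answers, never have to be described. *)
Lemma planner_calls_foreach (R : realType) (n : nat) (A S : Type)
    (planner : curve R n -> 'rV[R]_n -> curve R n)
    (body : A -> S -> prog R n S) (c : nat) (s : seq A) (st : S) :
  (forall a st', planner_calls planner (body a st') = c) ->
  planner_calls planner (foreach s body st) = size s * c.
Proof.
move=> body_calls; elim: s st => [//|a s IHs] st /=.
by rewrite planner_calls_bind body_calls IHs mulSn.
Qed.

Theorem theorem2 (R : realType) (n : nat) (pb : recognition_problem R n)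
    (planner : curve R n -> 'rV[R]_n -> curve R n)
    (cost : trajectory R n -> R)
    (recompute : trajectory R n -> curve R n -> bool)
    (prune : curve R n -> curve R n -> 'rV[R]_n -> bool)
    (os : seq (curve R n)) :
  is_planner pb planner ->
  perm_eq os (enum_fset (observations pb)) ->
  (forall m o, recompute m o = false) ->
  planner_calls planner
    (online_goal_recognition pb cost recompute prune os)
  = #|` goals pb|%fset.
Proof.
move=> _ _ no_recompute; rewrite planner_calls_bind /initial_plans.
(* Initialisation: the body is a single [Call] followed by [Ret], whence [c = 1]. *)
rewrite (planner_calls_foreach _ _ _ _ _ _ 1) // muln1.
(* Main loop, with [c = 0]; what remains is the length of the goal enumeration, which is the
   cardinality by definition. *)
rewrite (planner_calls_foreach _ _ _ _ _ _ 0) ?muln0 ?addn0 //.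
(* The body now reduces to a bare [Ret]. *)
by move=> o st; rewrite /observe no_recompute.
Qed.
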